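(* For $m_1\in[m]$ let $$\Theta_{\mathrm U}(m_1)=\min_{\mathbf B\in\mathcal B_{m_1}}\ \min_{\mathbf x\in\mathcal X}\ \max_{\mathbb P_{\mathrm I}\in\mathcal D_{\mathrm U}}\ \mathbb E_{\mathbb P_{\mathrm I}}\left[f\left(\mathbf x,\mathbf U\boldsymbol\Lambda^{1/2}\boldsymbol\xi_{\mathrm I}+\boldsymbol\mu\right)\right],$$ and let $$\Theta_{\mathrm M}(m)=\min_{\mathbf x\in\mathcal X}\ \max_{\mathbb P_{\mathrm I}\in\mathcal D_{\mathrm M}}\ \mathbb E_{\mathbb P_{\mathrm I}}\left[f\left(\mathbf x,\mathbf U\boldsymbol\Lambda^{1/2}\boldsymbol\xi_{\mathrm I}+\boldsymbol\mu\right)\right],$$ where the data and the sets $\mathcal B_{m_1},\mathcal D_{\mathrm U},\mathcal D_{\mathrm M}$ are as in the context. Then: (i) $\Theta_{\mathrm U}(m_1)\ge\Theta_{\mathrm M}(m)$ for any $m_1\le m$; (ii) $\Theta_{\mathrm U}(m_1)\ge\Theta_{\mathrm U}(m_2)$ for any $m_1<m_2\le m$; (iii) $\Theta_{\mathrm U}(m)=\Theta_{\mathrm M}(m)$.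
   Context: Setting. $[N]=\{1,\dots,N\}$; $m,n,l,K$ are positive integers; $\gamma_1\ge 0$, $\gamma_2\ge 1$; $\boldsymbol\mu\in\mathbb R^m$; $\boldsymbol\Sigma\in\mathbb R^{m\times m}$ is symmetric positive definite with eigenvalue decomposition $\boldsymbol\Sigma=\mathbf U\boldsymbol\Lambda\mathbf U^\top$, $\mathbf U$ orthogonal, $\boldsymbol\Lambda$ diagonal with nonincreasing diagonal entries. $\mathcal X\subseteq\mathbb R^n$. The support set is $\mathcal S=\{\boldsymbol\xi\in\mathbb R^m: \mathbf A\boldsymbol\xi\le\mathbf b\}$ with $\mathbf A\in\mathbb R^{l\times m}$, $\mathbf b\in\mathbb R^l$, and has at least one interior point. The function $f$ is piecewise linear convex in $\boldsymbol\xi$: $f(\mathbf x,\boldsymbol\xi)=\max_{k\in[K]}\{y_k^0(\mathbf x)+y_k(\mathbf x)^\top\boldsymbol\xi\}$ with $y_k^0(\mathbf x)\in\mathbb R$ and $y_k(\mathbf x)\in\mathbb R^m$ affine in $\mathbf x$. $\preceq$ is the positive semidefinite (Loewner) order and $\mathbf I_d$ the $d\times d$ identity. $\mathcal B_{m_1}=\{\mathbf B\in\mathbb R^{m\times m_1}:\mathbf B^\top\mathbf B=\mathbf I_{m_1}\}$ and $\mathcal S_{\mathrm I}=\{\boldsymbol\xi_{\mathrm I}\in\mathbb R^m:\mathbf U\boldsymbol\Lambda^{1/2}\boldsymbol\xi_{\mathrm I}+\boldsymbol\mu\in\mathcal S\}$. $\mathcal D_{\mathrm M}$ is the set of probability distributions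 $\mathbb P_{\mathrm I}$ of a random vector $\boldsymbol\xi_{\mathrm I}\in\mathbb R^m$ with $\mathbb P_{\mathrm I}(\boldsymbol\xi_{\mathrm I}\in\mathcal S_{\mathrm I})=1$, $\mathbb E_{\mathbb P_{\mathrm I}}[\boldsymbol\xi_{\mathrm I}^\top]\,\mathbb E_{\mathbb P_{\mathrm I}}[\boldsymbol\xi_{\mathrm I}]\le\gamma_1$, $\mathbb E_{\mathbb P_{\mathrm I}}[\boldsymbol\xi_{\mathrm I}\boldsymbol\xi_{\mathrm I}^\top]\preceq\gamma_2\mathbf I_m$. For given $\mathbf B\in\mathcal B_{m_1}$, $\mathcal D_{\mathrm U}$ is the set of probability distributions $\mathbb P_{\mathrm I}$ of a random vector $\boldsymbol\xi_{\mathrm I}\in\mathbb R^m$ with $\mathbb P_{\mathrm I}(\boldsymbol\xi_{\mathrm I}\in\mathcal S_{\mathrm I})=1$, $\mathbb E_{\mathbb P_{\mathrm I}}[\boldsymbol\xi_{\mathrm I}^\top]\,\mathbb E_{\mathbb P_{\mathrm I}}[\boldsymbol\xi_{\mathrm I}]\le\gamma_1$, $\mathbb E_{\mathbb P_{\mathrm I}}[\mathbf B^\top\boldsymbol\xi_{\mathrm I}\boldsymbol\xi_{\mathrm I}^\top\mathbf B]\preceq\gamma_2\mathbf I_{m_1}$. The value of a min (max) problem means its optimal value, i.e. the infimum (supremum) in the extended reals. *)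

(* Defs.v *)
From HB Require Import structures.
From mathcomp Require Import all_boot all_order all_algebra.
From mathcomp Require Import all_classical all_reals all_analysis.

Set Implicit Arguments.
Unset Strict Implicit.
Unset Printing Implicit Defensive.

Import Order.TTheory GRing.Theory Num.Theory.
Import numFieldNormedType.Exports.

Local Open Scope classical_set_scope.
Local Open Scope ring_scope.

Section MatrixOrder.
Variable R : realType.

Definition posdef (d : nat) (M : 'M[R]_d) : Prop :=
  M^T = M /\ forall u : 'cV[R]_d, u != 0 -> 0 < (u^T *m M *m u) 0 0.

Definition possemidef (d : nat) (M : 'M[R]_d) : Prop :=
  M^T = M /\ forall u : 'cV[R]_d, 0 <= (u^T *m M *m u) 0 0.

Definition loewner_le (d : nat) (M N : 'M[R]_d) : Prop := possemidef (N - M).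

Definition eigen_decomposition (d : nat) (M U : 'M[R]_d) (lam : 'rV[R]_d) :
    Prop :=
  [/\ U^T *m U = 1%:M,
      forall i j : 'I_d, (i <= j)%N -> lam 0 j <= lam 0 i &
      M = U *m diag_mx lam *m U^T].

Definition orthonormal_columns (m m1 : nat) : set 'M[R]_(m, m1) :=
  [set B | B^T *m B = 1%:M].

End MatrixOrder.

Definition affine_fun (R : realType) (n : nat) (V : lmodType R)
    (g : 'cV[R]_n -> V) : Prop :=
  exists (L : {linear 'cV[R]_n -> V}) (c : V), forall x, g x = L x + c.

Section Probability.
Variables (R : realType) (m : nat).

Definition borel_cV := g_sigma_algebraType (@open 'cV[R]_m).

Variable P : probability borel_cV R.

Definition mx_integrable (p q : nat) (Y : 'cV[R]_m -> 'M[R]_(p, q)) : Prop :=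
  forall i j, P.-integrable setT (fun xi : borel_cV => (Y xi i j)%:E).

(* Entrywise expectation; meaningful when mx_integrable P Y. *)
Definition mx_expectation (p q : nat) (Y : 'cV[R]_m -> 'M[R]_(p, q)) :
    'M[R]_(p, q) :=
  \matrix_(i, j) fine ('E_P[(fun xi : borel_cV => Y xi i j)])%E.

End Probability.

Section Problem.
Variables (R : realType) (m n l K : nat).

Definition polyhedron (A : 'M[R]_(l, m)) (b : 'cV[R]_l) : set 'cV[R]_m :=
  [set xi | forall i : 'I_l, (A *m xi) i 0 <= b i 0].

(* The maximum is taken in \bar R, where -oo is neutral; it is a real number
   as soon as 0 < K. *)
Definition max_affine (y0 : 'I_K -> 'cV[R]_n -> R)
    (y : 'I_K -> 'cV[R]_n -> 'cV[R]_m) (x : 'cV[R]_n) (xi : 'cV[R]_m) : R :=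
  fine (\big[maxe/-oo%E]_(k < K) (y0 k x + ((y k x)^T *m xi) 0 0)%:E).

Definition destandardize (U : 'M[R]_m) (lam : 'rV[R]_m) (mu xiI : 'cV[R]_m) :
    'cV[R]_m :=
  U *m diag_mx (map_mx Num.sqrt lam) *m xiI + mu.

Definition standardized_support (U : 'M[R]_m) (lam : 'rV[R]_m)
    (mu : 'cV[R]_m) (S : set 'cV[R]_m) : set 'cV[R]_m :=
  [set xiI | S (destandardize U lam mu xiI)].

(* The integrability clauses in the next two definitions say that the
   expectations in the moment constraints exist and are finite. *)
Definition ambiguity_M (gamma1 gamma2 : R) (SI : set 'cV[R]_m) :
    set (probability (borel_cV R m) R) :=
  [set P : probability (borel_cV R m) R | [/\ P SI = 1%E,
      mx_integrable P id /\ mx_integrable P (fun xi => xi *m xi^T),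
      (mx_expectation P trmx *m mx_expectation P id) 0 0 <= gamma1 &
      loewner_le (mx_expectation P (fun xi => xi *m xi^T)) gamma2%:M]].

Definition ambiguity_U (m1 : nat) (B : 'M[R]_(m, m1)) (gamma1 gamma2 : R)
    (SI : set 'cV[R]_m) : set (probability (borel_cV R m) R) :=
  [set P : probability (borel_cV R m) R | [/\ P SI = 1%E,
      mx_integrable P id /\
        mx_integrable P (fun xi => B^T *m xi *m xi^T *m B),
      (mx_expectation P trmx *m mx_expectation P id) 0 0 <= gamma1 &
      loewner_le (mx_expectation P (fun xi => B^T *m xi *m xi^T *m B))
        gamma2%:M]].

Definition worst_case (D : set (probability (borel_cV R m) R))
    (h : 'cV[R]_m -> R) : \bar R :=
  ereal_sup [set 'E_P[(h : borel_cV R m -> R)]%E | P in D].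

Variables (X : set 'cV[R]_n) (f : 'cV[R]_n -> 'cV[R]_m -> R).
Variables (S : set 'cV[R]_m) (mu : 'cV[R]_m) (U : 'M[R]_m) (lam : 'rV[R]_m).
Variables (gamma1 gamma2 : R).

Let SI := standardized_support U lam mu S.

Definition Theta_M : \bar R :=
  ereal_inf [set worst_case (ambiguity_M gamma1 gamma2 SI)
                   (fun xiI => f x (destandardize U lam mu xiI)) | x in X].

Definition Theta_U (m1 : nat) : \bar R :=
  ereal_inf [set
    ereal_inf [set worst_case (ambiguity_U B gamma1 gamma2 SI)
                     (fun xiI => f x (destandardize U lam mu xiI)) | x in X]
    | B in @orthonormal_columns R m m1].

End Problem.

(* Main.v *)
Require Import Defs.
From HB Require Import structures.
From mathcomp Require Import all_boot all_order all_algebra.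
From mathcomp Require Import all_classical all_reals all_analysis.

Set Implicit Arguments.
Unset Strict Implicit.
Unset Printing Implicit Defensive.

Import Order.TTheory GRing.Theory Num.Theory.
Import numFieldNormedType.Exports.

Local Open Scope classical_set_scope.
Local Open Scope ring_scope.

(** An orthonormal frame [B] constrains a distribution only through the
    compressed second moment [E[B^T xi xi^T B]].  If [B' = B *m C] with both
    frames orthonormal, then [C^T C = B'^T B' = I], and by linearity
    of expectation [gamma2 I - E[B'^T xi xi^T B'] =
    C^T (gamma2 I - E[B^T xi xi^T B]) C]: the congruence by [C]
    keeps this gap positive semidefinite.  So the ambiguity
    set of [B] is contained in that of [B'] ([ambiguity_U_mulmx]), and passing
    to a coarser frame can only raise the worst-case expectation
    ([frame_value_mulmx]).

    The moment-based problem is the case of the full frame [B = I]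
    ([ambiguity_U1]), and every [B] is [I *m B], so the moment-based value is a
    lower bound for all frames, attained at [I] in full dimension.  For the
    monotonicity in the number of columns, every orthonormal frame with fewer
    than [m] columns is part of a larger one, obtained by repeatedly adjoining
    a unit vector orthogonal to its columns ([orthonormal_columns_extend]). *)

(** * Orthonormal frames and their extension *)

Section OrthonormalColumns.
Variable R : realType.
Implicit Types m p q : nat.

Lemma orthonormal_columns1 m : orthonormal_columns (1%:M : 'M[R]_m).
Proof. by rewrite /orthonormal_columns /= trmx1 mul1mx. Qed.

Lemma row_mul_tr_gt0 m (u : 'rV[R]_m) : u != 0 -> 0 < (u *m u^T) 0 0.
Proof.
move=> /rV0Pn[i ui0]; rewrite mxE (bigD1 i) //= mxE ltr_wpDr //.
  by apply: sumr_ge0 => j _; rewrite mxE -expr2 sqr_ge0.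
by rewrite -expr2 exprn_even_gt0.
Qed.

(** Fewer than [m] columns cannot span the whole space: the left kernel of [B]
    is nonzero and any of its vectors can be normalized. *)
Lemma orthogonal_unit_vector m p (B : 'M[R]_(m, p)) : (p < m)%N ->
  exists w : 'cV[R]_m, B^T *m w = 0 /\ w^T *m w = 1%:M.
Proof.
move=> ltpm.
have /rowV0Pn[u uB u0] : kermx B != 0.
  rewrite kermx_eq0 /row_free neq_ltn; apply/orP; left.
  exact: leq_ltn_trans (rank_leq_col B) ltpm.
have uB0 : u *m B = 0 by apply/sub_kermxP.
have N_gt0 := row_mul_tr_gt0 u0; set N := (u *m u^T) 0 0 in N_gt0.
have sN0 : Num.sqrt N != 0 by rewrite lt0r_neq0 // sqrtr_gt0.
exists ((Num.sqrt N)^-1 *: u^T); split.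
  by rewrite -scalemxAr -trmx_mul uB0 trmx0 scaler0.
rewrite [(_ *: _)^T]linearZ /= trmxK -scalemxAl -scalemxAr scalerA.
rewrite [u *m _]mx11_scalar -/N scale_scalar_mx -invfM.
by rewrite -expr2 sqr_sqrtr ?ltW // mulVf ?lt0r_neq0.
Qed.

(** Columns are adjoined one at a time, each a unit vector orthogonal to the
    previous ones; [C] selects the columns of [B] inside [B']. *)
Lemma orthonormal_columns_extend m p q (B : 'M[R]_(m, p)) :
    (p <= q <= m)%N -> orthonormal_columns B ->
  exists (B' : 'M[R]_(m, q)) (C : 'M[R]_(q, p)),
    orthonormal_columns B' /\ B = B' *m C.
Proof.
elim: q => [|q IHq] /andP[lepq leqm] oB; move: lepq; rewrite leq_eqVlt.
  move=> /orP[/eqP p0|//]; move: p0 B oB => -> B oB.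
  by exists B, 1%:M; rewrite mulmx1.
move=> /orP[/eqP pq|ltpq].
  by move: pq B oB {IHq} => -> B oB; exists B, 1%:M; rewrite mulmx1.
have [|B' [C [oB' ->]]] := IHq _ oB.
  by rewrite -ltnS ltpq ltnW.
have [w [Bw ww]] := orthogonal_unit_vector B' leqm.
(* In front rather than at the end: [1 + q] is convertible to [q.+1]. *)
exists (row_mx w B' : 'M[R]_(m, 1 + q)), (col_mx 0 C : 'M[R]_(1 + q, p)).
split; last by rewrite (mul_row_col w B' 0 C) mulmx0 add0r.
have wB : w^T *m B' = 0 by rewrite -[B']trmxK -trmx_mul Bw trmx0.
have BB : B'^T *m B' = 1%:M := oB'.
rewrite /orthonormal_columns /= (tr_row_mx w B') (mul_col_row w^T B'^T w B').
by rewrite ww Bw wB BB; exact: esym (@scalar_mx_block R 1 q 1).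
Qed.

Lemma loewner_le_congr p q (M N : 'M[R]_p) (C : 'M[R]_(p, q)) :
  loewner_le M N -> loewner_le (C^T *m M *m C) (C^T *m N *m C).
Proof.
move=> [symNM psdNM]; rewrite /loewner_le -mulmxBl -mulmxBr; split.
  by rewrite !trmx_mul trmxK symNM mulmxA.
move=> u; have := psdNM (C *m u).
by rewrite trmx_mul !mulmxA.
Qed.

End OrthonormalColumns.

(** * Linearity of the entrywise expectation *)

Section MatrixExpectation.
Variables (R : realType) (m : nat) (P : probability (borel_cV R m) R).

Let integrable_lincomb (I : finType) (a : I -> R) (g : I -> 'cV[R]_m -> R) :
    (forall i, P.-integrable setT (fun xi : borel_cV R m => (g i xi)%:E)) ->
  P.-integrable setT
    (fun xi : borel_cV R m => (\sum_i a i * g i xi)%:E).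
Proof.
move=> ig; under eq_fun do rewrite -sumEFin.
apply: integrable_sum => // i _; under eq_fun do rewrite EFinM.
exact: integrableZl.
Qed.

Let expectation_lincomb (I : finType) (a : I -> R) (g : I -> 'cV[R]_m -> R) :
    (forall i, P.-integrable setT (fun xi : borel_cV R m => (g i xi)%:E)) ->
  fine 'E_P[(fun xi : borel_cV R m => \sum_i a i * g i xi)%R]%E =
  \sum_i a i * fine 'E_P[(g i : borel_cV R m -> R)]%E.
Proof.
move=> ig; rewrite unlock; under eq_integral do rewrite -sumEFin.
rewrite integral_sum //; last first.
  by move=> i; under eq_fun do rewrite EFinM; exact: integrableZl.
under eq_bigr do (under eq_integral do rewrite EFinM; rewrite integralZl//).
rewrite -sum_fine; last first.
  by move=> i _; rewrite fin_numM // integrable_fin_num.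
by apply: eq_bigr => i _; rewrite fineM // integrable_fin_num.
Qed.

Variables (p q : nat) (Y : 'cV[R]_m -> 'M[R]_(p, q)).
Hypothesis intY : mx_integrable P Y.

Let mulmxlE r (C : 'M[R]_(r, p)) i j :
  (fun xi => (C *m Y xi) i j) = (fun xi => \sum_k C i k * Y xi k j).
Proof. by apply/funext => xi; rewrite mxE. Qed.

Let mulmxrE r (C : 'M[R]_(q, r)) i j :
  (fun xi => (Y xi *m C) i j) = (fun xi => \sum_k C k j * Y xi i k).
Proof.
by apply/funext => xi; rewrite mxE; apply: eq_bigr => k _; rewrite mulrC.
Qed.

Lemma mx_integrable_mull r (C : 'M[R]_(r, p)) :
  mx_integrable P (fun xi => C *m Y xi).
Proof.
move=> i j.
rewrite [X in _.-integrable _ X](congr1 (fun h => EFin \o h) (mulmxlE C i j)).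
exact: (@integrable_lincomb _ (C i) (fun k xi => Y xi k j)).
Qed.

Lemma mx_integrable_mulr r (C : 'M[R]_(q, r)) :
  mx_integrable P (fun xi => Y xi *m C).
Proof.
move=> i j.
rewrite [X in _.-integrable _ X](congr1 (fun h => EFin \o h) (mulmxrE C i j)).
exact: (@integrable_lincomb _ (C^~ j) (fun k xi => Y xi i k)).
Qed.

Lemma mx_expectation_mull r (C : 'M[R]_(r, p)) :
  mx_expectation P (fun xi => C *m Y xi) = C *m mx_expectation P Y.
Proof.
apply/matrixP => i j; rewrite !mxE mulmxlE.
rewrite (expectation_lincomb (C i) (g := fun k xi => Y xi k j)) //.
by apply: eq_bigr => k _; rewrite mxE.
Qed.

Lemma mx_expectation_mulr r (C : 'M[R]_(q, r)) :
  mx_expectation P (fun xi => Y xi *m C) = mx_expectation P Y *m C.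
Proof.
apply/matrixP => i j; rewrite !mxE mulmxrE.
rewrite (expectation_lincomb (C^~ j) (g := fun k xi => Y xi i k)) //.
by apply: eq_bigr => k _; rewrite mxE mulrC.
Qed.

End MatrixExpectation.

(** * Comparison of ambiguity sets and of optimal values *)

Section Comparison.
Variables (R : realType) (m : nat) (gamma1 gamma2 : R) (SI : set 'cV[R]_m).

(** The congruence by [C] turns the bound [gamma2 I] into [gamma2 C^T C], which
    is again [gamma2 I] because both frames are orthonormal. *)
Lemma ambiguity_U_mulmx p q (B : 'M[R]_(m, p)) (C : 'M[R]_(p, q)) :
    orthonormal_columns B -> orthonormal_columns (B *m C) ->
  ambiguity_U B gamma1 gamma2 SI `<=` ambiguity_U (B *m C) gamma1 gamma2 SI.
Proof.
rewrite /orthonormal_columns /= => oB oBC P [PS [intid intB] mean second].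
have CC : C^T *m C = 1%:M.
  by rewrite -oBC trmx_mul mulmxA -(mulmxA C^T) oB mulmx1.
have compressE : (fun xi : 'cV[R]_m => (B *m C)^T *m xi *m xi^T *m (B *m C)) =
    (fun xi => C^T *m (B^T *m xi *m xi^T *m B) *m C).
  by apply/funext => xi; rewrite trmx_mul !mulmxA.
rewrite /ambiguity_U /= compressE.
have intCB := mx_integrable_mull intB C^T.
split=> //; first by split=> //; exact: (mx_integrable_mulr intCB C).
rewrite (mx_expectation_mulr intCB) (mx_expectation_mull intB).
have := loewner_le_congr C second.
by rewrite mul_mx_scalar -scalemxAl CC scalemx1.
Qed.

Lemma ambiguity_U1 :
  ambiguity_U (1%:M : 'M[R]_m) gamma1 gamma2 SI = ambiguity_M gamma1 gamma2 SI.
Proof.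
apply/funext => P; rewrite /ambiguity_U /ambiguity_M /=.
suff -> : (fun xi : 'cV[R]_m => (1%:M : 'M[R]_m)^T *m xi *m xi^T *m 1%:M) =
          (fun xi => xi *m xi^T) by [].
by apply/funext => xi; rewrite trmx1 mul1mx mulmx1.
Qed.

Lemma worst_case_subset (D D' : set (probability (borel_cV R m) R))
    (h : 'cV[R]_m -> R) :
  D `<=` D' -> (worst_case D h <= worst_case D' h)%E.
Proof. by move=> DD'; apply/ereal_sup_le/image_subset. Qed.

Variables (T : Type) (X : set T) (h : T -> 'cV[R]_m -> R).

Definition frame_value p (B : 'M[R]_(m, p)) : \bar R :=
  ereal_inf [set worst_case (ambiguity_U B gamma1 gamma2 SI) (h x) | x in X].

Lemma frame_value_mulmx p q (B : 'M[R]_(m, p)) (C : 'M[R]_(p, q)) :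
    orthonormal_columns B -> orthonormal_columns (B *m C) ->
  (frame_value B <= frame_value (B *m C))%E.
Proof.
move=> oB oBC; apply: le_ereal_inf_tmp => _ [x Xx <-].
apply: (le_trans (ereal_inf_lbound (imageP _ Xx))).
exact/worst_case_subset/ambiguity_U_mulmx.
Qed.

End Comparison.

Theorem theorem4 (R : realType) (m n l K : nat)
  (m_gt0 : (0 < m)%N) (n_gt0 : (0 < n)%N) (l_gt0 : (0 < l)%N)
  (K_gt0 : (0 < K)%N)
  (gamma1 gamma2 : R) (gamma1_ge0 : 0 <= gamma1) (gamma2_ge1 : 1 <= gamma2)
  (mu : 'cV[R]_m) (Sigma U : 'M[R]_m) (lam : 'rV[R]_m)
  (Sigma_posdef : posdef Sigma)
  (Sigma_eigen : eigen_decomposition Sigma U lam)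
  (X : set 'cV[R]_n)
  (A : 'M[R]_(l, m)) (b : 'cV[R]_l)
  (S_interior : exists xi0 : 'cV[R]_m, interior (polyhedron A b) xi0)
  (y0 : 'I_K -> 'cV[R]_n -> R) (y : 'I_K -> 'cV[R]_n -> 'cV[R]_m)
  (y0_affine : forall k : 'I_K, @affine_fun R n R^o (y0 k))
  (y_affine : forall k : 'I_K, affine_fun (y k)) :
  let ThetaU :=
    Theta_U X (max_affine y0 y) (polyhedron A b) mu U lam gamma1 gamma2 in
  let ThetaM :=
    Theta_M X (max_affine y0 y) (polyhedron A b) mu U lam gamma1 gamma2 in
  [/\ (forall m1 : nat, (0 < m1)%N -> (m1 <= m)%N -> (ThetaM <= ThetaU m1)%E),
      (forall m1 m2 : nat, (0 < m1)%N -> (m1 < m2)%N -> (m2 <= m)%N ->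
         (ThetaU m2 <= ThetaU m1)%E) &
      ThetaU m = ThetaM].
Proof.
move=> ThetaU ThetaM.
pose V p (B : 'M[R]_(m, p)) := frame_value gamma1 gamma2
  (standardized_support U lam mu (polyhedron A b)) X
  (fun x xiI => max_affine y0 y x (destandardize U lam mu xiI)) B.
have ThetaUE p :
  ThetaU p = ereal_inf [set V p B | B in @orthonormal_columns R m p] by [].
have ThetaME : ThetaM = V m 1%:M by rewrite /V /frame_value ambiguity_U1.
have leMU p : (ThetaM <= ThetaU p)%E.
  rewrite ThetaME ThetaUE; apply: le_ereal_inf_tmp => _ [B oB <-].
  rewrite -[B]mul1mx; apply: frame_value_mulmx; last by rewrite mul1mx.
  exact: orthonormal_columns1.
split=> [m1 _ _|m1 m2 _ lt12 le2m|]; first exact: leMU.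
  rewrite !ThetaUE; apply: le_ereal_inf_tmp => _ [B oB <-].
  have [|B' [C [oB' BE]]] := orthonormal_columns_extend (q := m2) _ oB.
    by rewrite ltnW.
  apply: (le_trans (ereal_inf_lbound (imageP _ oB'))).
  by rewrite BE; apply: frame_value_mulmx; rewrite -?BE.
apply/le_anti/andP; split; last exact: leMU.
rewrite ThetaME ThetaUE; apply: ereal_inf_lbound; apply: imageP.
exact: orthonormal_columns1.
Qed.
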